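(* Let $d>2$ be an integer, let $B>0$, and put $A=-\frac{d-2}{2}\sqrt{\frac{B}{d-1}}$, $r_0=\sqrt[4]{\frac{B}{d-1}}$. Consider the scalar-flat metric of Eguchi-Hanson type $$g=\left(1-\frac{2A}{r^2}-\frac{B}{r^4}\right)^{-1}\mathrm{d}r^{2}+r^{2}\left(\sigma_{1}^{2}+\sigma_{2}^{2}+\left(1-\frac{2A}{r^2}-\frac{B}{r^4}\right)\sigma_{3}^{2}\right).$$ Then for all integers $m,n$ and all complex constants $C_1,C_2,C_3,C_4$, the spinor $$\Phi=\mathrm{e}^{\mathrm{i}(n+\frac12)\phi}\begin{pmatrix}C_1\,\mathrm{e}^{\mathrm{i}\frac d2(m+\frac12)\psi}u_1(r)v_1(\theta)\\ C_2\,\mathrm{e}^{\mathrm{i}\frac d2(m-\frac12)\psi}u_2(r)v_2(\theta)\\ C_3\,\mathrm{e}^{\mathrm{i}\frac d2(m+\frac12)\psi}u_3(r)v_3(\theta)\\ C_4\,\mathrm{e}^{\mathrm{i}\frac d2(m-\frac12)\psi}u_4(r)v_4(\theta)\end{pmatrix}$$ is a harmonic spinor for $g$, i.e. $\mathcal D\Phi=\sum_{k=1}^4 e_k\cdot\nabla_{e_k}\Phi=0$, where $$u_1(r)=\big(r^2-r_0^2\big)^{\frac{1-d-dm}{2d}}\big(r^2+(d-1)r_0^2\big)^{-\frac{1-d-dm}{2d}-\frac{d(1+2m)}{4}},$$ $$u_2(r)=\big(r^2-r_0^2\big)^{\frac{1-d+dm}{2d}}\big(r^2+(d-1)r_0^2\big)^{-\frac{1-d+dm}{2d}-\frac{d(1-2m)}{4}},$$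 $$u_3(r)=\frac1r\big(r^2-r_0^2\big)^{-\frac12-\frac{1-d-dm}{2d}}\big(r^2+(d-1)r_0^2\big)^{-\frac12+\frac{1-d-dm}{2d}+\frac{d(1+2m)}{4}},$$ $$u_4(r)=\frac1r\big(r^2-r_0^2\big)^{-\frac12-\frac{1-d+dm}{2d}}\big(r^2+(d-1)r_0^2\big)^{-\frac12+\frac{1-d+dm}{2d}+\frac{d(1-2m)}{4}},$$ and $$v_1(\theta)=v_3(\theta)=\Big(\sin\frac\theta2\Big)^{n+\frac12-\frac d2(m+\frac12)}\Big(\cos\frac\theta2\Big)^{-n-\frac12-\frac d2(m+\frac12)},$$ $$v_2(\theta)=v_4(\theta)=\Big(\sin\frac\theta2\Big)^{-n-\frac12+\frac d2(m-\frac12)}\Big(\cos\frac\theta2\Big)^{n+\frac12+\frac d2(m-\frac12)}.$$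
   Context: The Cartan-Maurer forms in the Euler angles $\theta,\phi,\psi$ are $$\sigma_{1}=\tfrac12(\sin\psi\,\mathrm{d}\theta-\sin\theta\cos\psi\,\mathrm{d}\phi),\quad \sigma_{2}=\tfrac12(-\cos\psi\,\mathrm{d}\theta-\sin\theta\sin\psi\,\mathrm{d}\phi),\quad \sigma_{3}=\tfrac12(\mathrm{d}\psi+\cos\theta\,\mathrm{d}\phi).$$ The coordinate ranges are $r\ge r_0$, $0\le\theta\le\pi$, $0\le\phi\le2\pi$, $0\le\psi\le\frac{4\pi}{d}$. Put $f=f(r)=\sqrt{1-\frac{2A}{r^2}-\frac{B}{r^4}}$, so that $g=f^{-2}\mathrm{d}r^2+r^2(\sigma_1^2+\sigma_2^2+f^2\sigma_3^2)$. The orthonormal coframe is $e^1=f^{-1}\mathrm{d}r$, $e^2=r\sigma_1$, $e^3=r\sigma_2$, $e^4=rf\sigma_3$, with dual orthonormal frame $$e_{1}=f\partial_{r},\quad e_{2}=\tfrac{2}{r}\Big(\sin\psi\,\partial_{\theta}-\tfrac{\cos\psi}{\sin\theta}\partial_{\phi}+\tfrac{\cos\theta\cos\psi}{\sin\theta}\partial_{\psi}\Big),$$ $$e_{3}=\tfrac{2}{r}\Big(-\cos\psi\,\partial_{\theta}-\tfrac{\sin\psi}{\sin\theta}\partial_{\phi}+\tfrac{\cos\theta\sin\psi}{\sin\theta}\partial_{\psi}\Big),\quad e_{4}=\tfrac{2}{rf}\partial_{\psi}.$$ These coordinate expressions, and the formulas for $\Phi$, are understood in the coordinate region $r>r_0$,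 $0<\theta<\pi$; $\Phi$ may be singular at $r=r_0$, $\theta=0$ or $\theta=\pi$. Spinors are written as column vectors $\Phi=(\Phi_1,\Phi_2,\Phi_3,\Phi_4)^t$ of complex-valued functions with respect to this frame, with Clifford multiplication by $e_i$ (where $e_i\cdot e_i=-1$) given by the $2\times2$-block matrices $$e_1\mapsto\begin{pmatrix}0&I\\ -I&0\end{pmatrix},\quad e_2\mapsto\begin{pmatrix}0&M_2\\ M_2&0\end{pmatrix},\quad e_3\mapsto\begin{pmatrix}0&M_3\\ M_3&0\end{pmatrix},\quad e_4\mapsto\begin{pmatrix}0&M_4\\ M_4&0\end{pmatrix},$$ $$I=\begin{pmatrix}1&0\\ 0&1\end{pmatrix},\quad M_2=\begin{pmatrix}0&\mathrm{i}\\ \mathrm{i}&0\end{pmatrix},\quad M_3=\begin{pmatrix}0&-1\\ 1&0\end{pmatrix},\quad M_4=\begin{pmatrix}\mathrm{i}&0\\ 0&-\mathrm{i}\end{pmatrix}.$$ The spin connection is $\nabla_{e_k}\Phi=e_k\Phi+\frac14\sum_{i,j=1}^4 g(\nabla_{e_k}e_i,e_j)\,e_i\cdot e_j\cdot\Phi$ (with the Levi-Civita connection inside $g(\cdot,\cdot)$ and $e_k\Phi$ the componentwise derivative). Explicitly, with $f'=\mathrm{d}f/\mathrm{d}r$, $$\nabla_{e_1}\Phi=e_1\Phi,\quad \nabla_{e_2}\Phi=e_2\Phi+\tfrac{f}{2r}(e_1\cdot e_2-e_3\cdot e_4)\cdot\Phi,\quad \nabla_{e_3}\Phi=e_3\Phi+\tfrac{f}{2r}(e_1\cdot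 e_3+e_2\cdot e_4)\cdot\Phi,$$ $$\nabla_{e_4}\Phi=e_4\Phi+\tfrac12\Big(\big(\tfrac{f}{r}+f'\big)e_1\cdot e_4+\big(\tfrac{f}{r}-\tfrac{2}{rf}\big)e_2\cdot e_3\Big)\cdot\Phi.$$ A spinor $\Phi$ is harmonic if it solves the Dirac equation $\mathcal D\Phi=\sum_{k=1}^4 e_k\cdot\nabla_{e_k}\Phi=0$. *)

(* Defs.v *)
From Stdlib Require Import Reals ZArith.
From Coquelicot Require Import Coquelicot.
Open Scope R_scope.

(** * Points, vectors and vector fields in the coordinates (r, theta, phi, psi)

    Coordinates, coframe and frame are numbered from 1 to 4, and index families
    are functions on [nat] of which only the values at 1, ..., 4 are used.
    The entries of [matrix] are numbered from 0, as in Coquelicot. *)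

Definition point : Type := (R * R * R * R)%type.

Definition vec (a b c d : R) (mu : nat) : R :=
  match mu with
  | 1%nat => a
  | 2%nat => b
  | 3%nat => c
  | 4%nat => d
  | _ => 0
  end.

Definition vfield : Type := point -> nat -> R.

Definition partial (mu : nat) (h : point -> R) (p : point) : R :=
  let '(r, theta, phi, psi) := p in
  match mu with
  | 1%nat => Derive (fun x => h (x, theta, phi, psi)) r
  | 2%nat => Derive (fun x => h (r, x, phi, psi)) theta
  | 3%nat => Derive (fun x => h (r, theta, x, psi)) phi
  | 4%nat => Derive (fun x => h (r, theta, phi, x)) psi
  | _ => 0
  end.

Definition dir (X : vfield) (h : point -> R) (p : point) : R :=
  sum_n_m (fun mu => X p mu * partial mu h p) 1 4.

Definition dirC (X : vfield) (h : point -> C) (p : point) : C :=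
  (dir X (fun q => Re (h q)) p, dir X (fun q => Im (h q)) p).

Definition bracket (X Y : vfield) : vfield := fun p nu =>
  dir X (fun q => Y q nu) p - dir Y (fun q => X q nu) p.

(** * The Levi-Civita connection *)

Definition metric : Type := point -> (nat -> R) -> (nat -> R) -> R.

Definition pairing (g : metric) (X Y : vfield) (p : point) : R :=
  g p (X p) (Y p).

(** [levi_civita g X Y Z] is the function g(nabla_X Y, Z), where nabla is the
    Levi-Civita connection of [g], given by the Koszul formula. *)
Definition levi_civita (g : metric) (X Y Z : vfield) (p : point) : R :=
  / 2 * (dir X (pairing g Y Z) p + dir Y (pairing g X Z) p
         - dir Z (pairing g X Y) p
         + pairing g (bracket X Y) Z p - pairing g (bracket X Z) Y p
         - pairing g (bracket Y Z) X p).

(** * The metric and its orthonormal frame *)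

Definition sigma1 (p : point) (X : nat -> R) : R :=
  let '(r, theta, phi, psi) := p in
  / 2 * (sin psi * X 2%nat - sin theta * cos psi * X 3%nat).

Definition sigma2 (p : point) (X : nat -> R) : R :=
  let '(r, theta, phi, psi) := p in
  / 2 * (- cos psi * X 2%nat - sin theta * sin psi * X 3%nat).

Definition sigma3 (p : point) (X : nat -> R) : R :=
  let '(r, theta, phi, psi) := p in
  / 2 * (X 4%nat + cos theta * X 3%nat).

Definition EH_metric (A B : R) : metric := fun p X Y =>
  let '(r, theta, phi, psi) := p in
  let W := 1 - 2 * A / r ^ 2 - B / r ^ 4 in
  / W * (X 1%nat * Y 1%nat)
  + r ^ 2 * (sigma1 p X * sigma1 p Y + sigma2 p X * sigma2 p Y
             + W * (sigma3 p X * sigma3 p Y)).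

Definition EH_f (A B r : R) : R := sqrt (1 - 2 * A / r ^ 2 - B / r ^ 4).

Definition EH_frame (A B : R) (k : nat) : vfield := fun p =>
  let '(r, theta, phi, psi) := p in
  match k with
  | 1%nat => vec (EH_f A B r) 0 0 0
  | 2%nat => vec 0
             (2 / r * sin psi)
             (2 / r * - (cos psi / sin theta))
             (2 / r * (cos theta * cos psi / sin theta))
  | 3%nat => vec 0
             (2 / r * - cos psi)
             (2 / r * - (sin psi / sin theta))
             (2 / r * (cos theta * sin psi / sin theta))
  | 4%nat => vec 0 0 0 (2 / (r * EH_f A B r))
  | _ => vec 0 0 0 0
  end.

(** * Clifford multiplication and the Dirac operator *)

Definition spinor : Type := @matrix C 4 1.
Definition spinor_field : Type := point -> spinor.

Definition Mscal {m n : nat} (c : C) (M : @matrix C m n) : @matrix C m n :=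
  mk_matrix m n (fun i j => Cmult c (coeff_mat (RtoC 0) M i j)).

(** The 2x2-block matrix with zero diagonal blocks, upper right block [P] and
    lower left block [Q]. *)
Definition off_diag (P Q : @matrix C 2 2) : @matrix C 4 4 :=
  mk_matrix 4 4 (fun i j =>
    match i, j with
    | (0 | 1)%nat, (2 | 3)%nat => coeff_mat (RtoC 0) P i (j - 2)%nat
    | (2 | 3)%nat, (0 | 1)%nat => coeff_mat (RtoC 0) Q (i - 2)%nat j
    | _, _ => RtoC 0
    end).

Definition M1 : @matrix C 2 2 :=
  [ [ RtoC 1, RtoC 0 ],
    [ RtoC 0, RtoC 1 ] ].
Definition M2 : @matrix C 2 2 :=
  [ [ RtoC 0, Ci ],
    [ Ci, RtoC 0 ] ].
Definition M3 : @matrix C 2 2 :=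
  [ [ RtoC 0, RtoC (-1) ],
    [ RtoC 1, RtoC 0 ] ].
Definition M4 : @matrix C 2 2 :=
  [ [ Ci, RtoC 0 ],
    [ RtoC 0, Copp Ci ] ].

Definition clifford (k : nat) : @matrix C 4 4 :=
  match k with
  | 1%nat => off_diag M1 (Mscal (RtoC (-1)) M1)
  | 2%nat => off_diag M2 M2
  | 3%nat => off_diag M3 M3
  | 4%nat => off_diag M4 M4
  | _ => mk_matrix 4 4 (fun _ _ => RtoC 0)
  end.

Definition cmul (k : nat) (s : spinor) : spinor :=
  Mmult (T := C_Ring) (clifford k) s.

Definition spinor_sum (s : nat -> spinor) : spinor :=
  mk_matrix 4 1 (fun i j =>
    sum_n_m (G := C_AbelianMonoid) (fun k => coeff_mat (RtoC 0) (s k) i j) 1 4).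

Definition spinor_dir (X : vfield) (Phi : spinor_field) : spinor_field :=
  fun p => mk_matrix 4 1 (fun i j =>
    dirC X (fun q => coeff_mat (RtoC 0) (Phi q) i j) p).

Definition spin_connection (g : metric) (e : nat -> vfield) (k : nat)
    (Phi : spinor_field) : spinor_field := fun p =>
  Mplus (G := C_AbelianMonoid) (spinor_dir (e k) Phi p)
    (Mscal (RtoC (/ 4))
       (spinor_sum (fun i => spinor_sum (fun j =>
          Mscal (RtoC (levi_civita g (e k) (e i) (e j) p))
                (cmul i (cmul j (Phi p))))))).

Definition dirac (g : metric) (e : nat -> vfield) (Phi : spinor_field)
    : spinor_field := fun p =>
  spinor_sum (fun k => cmul k (spin_connection g e k Phi p)).

Definition spinor_zero : spinor := mk_matrix 4 1 (fun _ _ => RtoC 0).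

(** [Derive] is total, so differentiability has to be required separately. *)
Definition spinor_differentiable (Phi : spinor_field) (p : point) : Prop :=
  forall i : nat, (i < 4)%nat ->
    ex_filterdiff (K := R_AbsRing)
      (U := prod_NormedModule _ (prod_NormedModule _ (prod_NormedModule _
              R_NormedModule R_NormedModule) R_NormedModule) R_NormedModule)
      (V := C_R_NormedModule)
      (fun q : point => coeff_mat (RtoC 0) (Phi q) i 0) (locally p).

Definition EH_region (r0 : R) (p : point) : Prop :=
  let '(r, theta, phi, psi) := p in r0 < r /\ 0 < theta < PI.

Definition harmonic_spinor (A B r0 : R) (Phi : spinor_field) : Prop :=
  forall p : point, EH_region r0 p ->
    spinor_differentiable Phi p /\
    dirac (EH_metric A B) (EH_frame A B) Phi p = spinor_zero.

(** * The separated solutions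

    Real powers of positive numbers are written with [Rpower]. *)

Definition expi (t : R) : C := (cos t, sin t).

Definition u1 (d m r0 r : R) : R :=
  Rpower (r ^ 2 - r0 ^ 2) ((1 - d - d * m) / (2 * d)) *
  Rpower (r ^ 2 + (d - 1) * r0 ^ 2)
    (- ((1 - d - d * m) / (2 * d)) - d * (1 + 2 * m) / 4).

Definition u2 (d m r0 r : R) : R :=
  Rpower (r ^ 2 - r0 ^ 2) ((1 - d + d * m) / (2 * d)) *
  Rpower (r ^ 2 + (d - 1) * r0 ^ 2)
    (- ((1 - d + d * m) / (2 * d)) - d * (1 - 2 * m) / 4).

Definition u3 (d m r0 r : R) : R :=
  1 / r *
  Rpower (r ^ 2 - r0 ^ 2) (- (1 / 2) - (1 - d - d * m) / (2 * d)) *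
  Rpower (r ^ 2 + (d - 1) * r0 ^ 2)
    (- (1 / 2) + (1 - d - d * m) / (2 * d) + d * (1 + 2 * m) / 4).

Definition u4 (d m r0 r : R) : R :=
  1 / r *
  Rpower (r ^ 2 - r0 ^ 2) (- (1 / 2) - (1 - d + d * m) / (2 * d)) *
  Rpower (r ^ 2 + (d - 1) * r0 ^ 2)
    (- (1 / 2) + (1 - d + d * m) / (2 * d) + d * (1 - 2 * m) / 4).

(** v1 = v3 and v2 = v4. *)
Definition v1 (d m n theta : R) : R :=
  Rpower (sin (theta / 2)) (n + 1 / 2 - d / 2 * (m + 1 / 2)) *
  Rpower (cos (theta / 2)) (- n - 1 / 2 - d / 2 * (m + 1 / 2)).

Definition v2 (d m n theta : R) : R :=
  Rpower (sin (theta / 2)) (- n - 1 / 2 + d / 2 * (m - 1 / 2)) *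
  Rpower (cos (theta / 2)) (n + 1 / 2 + d / 2 * (m - 1 / 2)).

Definition EH_spinor (d m n r0 : R) (C1 C2 C3 C4 : C) : spinor_field := fun p =>
  let '(r, theta, phi, psi) := p in
  Mscal (m := 4) (n := 1) (expi ((n + 1 / 2) * phi))
    [ [ C1 * expi (d / 2 * (m + 1 / 2) * psi) * u1 d m r0 r * v1 d m n theta ],
      [ C2 * expi (d / 2 * (m - 1 / 2) * psi) * u2 d m r0 r * v2 d m n theta ],
      [ C3 * expi (d / 2 * (m + 1 / 2) * psi) * u3 d m r0 r * v1 d m n theta ],
      [ C4 * expi (d / 2 * (m - 1 / 2) * psi) * u4 d m r0 r * v2 d m n theta ]
    ]%C.

(* Main.v *)
Require Import Defs.
From Stdlib Require Import Reals ZArith Lra Lia.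
From Coquelicot Require Import Coquelicot.
Open Scope R_scope.

(** The proof computes the Dirac operator of the metric once and for all in the
    given frame and then separates variables.

    Geometry. The brackets of the frame fields are combinations of the frame
    fields whose coefficients depend on [r] alone ([EH_frame_bracket]). Since the
    frame is orthonormal, the Koszul formula reduces to these structure functions
    ([EH_levi_civita]), and the Dirac operator of an arbitrary spinor field becomes
    [e1 . (D1 + h) + e2 . D2 + e3 . D3 + e4 . D4 - kappa e2 . e3 . e4], where the
    dots are Clifford products, [Dk] is the componentwise derivative along [ek],
    [h] is half the mean curvature of the hypersurfaces [r = const] and
    [kappa = f/(2r) + 1/(rf)] ([EH_dirac]). It exchanges the blocks
    [(Phi1, Phi2)] and [(Phi3, Phi4)], and [e2 . e3 . e4] is minus the identity
    between the blocks.

    Separation. Every component of the spinor is a mode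
    [expi (N phi) c expi (mu psi) u(r) v(theta)], so every vector field acts on it
    as a scalar built from [N], [mu] and the logarithmic derivatives of [u] and [v]
    ([dirC_mode]). Here [i D2 - D3] and [i D2 + D3] are
    [2/r exp(i psi) (d_theta - i/sin theta d_phi + i cot theta d_psi)] and the
    negative of its complex conjugate; they are the only operators that map one
    index of a block to the other. The exponents of [v1] and [v2] are chosen so
    that each component is annihilated by the one that acts on it. What remains is
    one ordinary differential equation for each component, which involves only
    [f^2] and its derivative once it is multiplied by [f]. For the given [A], [B] and [r0] one has
    [f^2 = (r^2 - r0^2)(r^2 + (d - 1) r0^2) / r^4], so that the equation is an
    identity of rational functions in the logarithmic derivative of a product of
    powers of the two factors and of [r] ([radial_identity_u1],
    [radial_identity_u3]). *)

(** * The frame and its brackets *)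

Definition EH_W (A B r : R) : R := 1 - 2 * A / r ^ 2 - B / r ^ 4.

(** Where the frame is defined and orthonormal; [A] and [B] are arbitrary in the
    geometric part, so positivity of [f^2] takes the place of [r0 < r]. *)
Definition EH_regular (A B : R) (p : point) : Prop :=
  let '(r, theta, phi, psi) := p in
  0 < r /\ 0 < EH_W A B r /\ 0 < sin theta.

Ltac nonzero :=
  repeat (apply Rmult_integral_contrapositive_currified);
  try apply pow_nonzero; try solve [ exact I | assumption | lra | nra ].

Lemma EH_f_sqr A B r : 0 < EH_W A B r -> EH_f A B r ^ 2 = EH_W A B r.
Proof. intros H. unfold EH_f. apply pow2_sqrt. apply Rlt_le, H. Qed.

Lemma EH_f_pos A B r : 0 < EH_W A B r -> 0 < EH_f A B r.
Proof. intros H. apply sqrt_lt_R0, H. Qed.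

(** The derivative of [EH_f], in the form [(f^2)' / (2 f)]. *)
Definition EH_df (A B r : R) : R := (2 * A / r ^ 3 + 2 * B / r ^ 5) / EH_f A B r.

Lemma is_derive_EH_f A B r :
  0 < r -> 0 < EH_W A B r -> is_derive (EH_f A B) r (EH_df A B r).
Proof.
  intros Hr HW. pose proof (EH_f_pos _ _ _ HW) as Hf.
  unfold EH_f, EH_df. auto_derive.
  - repeat split; nonzero.
  - match goal with |- context [ sqrt (1 + - ?a + - ?b) ] =>
      change (sqrt (1 + - a + - b)) with (EH_f A B r) end.
    field. split; lra.
Qed.

(** The partial derivatives of the frame coefficients, [mu] being the variable of
    differentiation and [nu] the component of the field. *)
Definition EH_frame_jacobian (A B : R) (k nu mu : nat) (p : point) : R :=
  let '(r, theta, phi, psi) := p in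
  let f := EH_f A B r in
  let f' := EH_df A B r in
  match k, nu, mu with
  | 1%nat, 1%nat, 1%nat => f'
  | 2%nat, 2%nat, 1%nat => - (2 / r ^ 2) * sin psi
  | 2%nat, 2%nat, 4%nat => 2 / r * cos psi
  | 2%nat, 3%nat, 1%nat => 2 / r ^ 2 * (cos psi / sin theta)
  | 2%nat, 3%nat, 2%nat => 2 / r * (cos psi * cos theta / sin theta ^ 2)
  | 2%nat, 3%nat, 4%nat => 2 / r * (sin psi / sin theta)
  | 2%nat, 4%nat, 1%nat => - (2 / r ^ 2) * (cos theta * cos psi / sin theta)
  | 2%nat, 4%nat, 2%nat => 2 / r * - (cos psi / sin theta ^ 2)
  | 2%nat, 4%nat, 4%nat => 2 / r * - (cos theta * sin psi / sin theta)
  | 3%nat, 2%nat, 1%nat => 2 / r ^ 2 * cos psi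
  | 3%nat, 2%nat, 4%nat => 2 / r * sin psi
  | 3%nat, 3%nat, 1%nat => 2 / r ^ 2 * (sin psi / sin theta)
  | 3%nat, 3%nat, 2%nat => 2 / r * (sin psi * cos theta / sin theta ^ 2)
  | 3%nat, 3%nat, 4%nat => 2 / r * - (cos psi / sin theta)
  | 3%nat, 4%nat, 1%nat => - (2 / r ^ 2) * (cos theta * sin psi / sin theta)
  | 3%nat, 4%nat, 2%nat => 2 / r * - (sin psi / sin theta ^ 2)
  | 3%nat, 4%nat, 4%nat => 2 / r * (cos theta * cos psi / sin theta)
  | 4%nat, 4%nat, 1%nat => - (2 * (f + r * f')) / (r * f) ^ 2
  | _, _, _ => 0
  end.

Lemma cos_sqr x : cos x ^ 2 = 1 - sin x ^ 2.
Proof. pose proof (sin2_cos2 x) as H. unfold Rsqr in H. simpl. lra. Qed.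

Lemma EH_frame_partial A B k nu mu p :
  EH_regular A B p ->
  partial mu (fun q => EH_frame A B k q nu) p = EH_frame_jacobian A B k nu mu p.
Proof.
  destruct p as [[[r theta] phi] psi]. intros (Hr & HW & Hs).
  pose proof (EH_f_pos _ _ _ HW) as Hf.
  pose proof (is_derive_EH_f _ _ _ Hr HW) as Hdf.
  pose proof (cos_sqr theta) as Hc.
  assert (He : ex_derive (EH_f A B) r) by (eexists; exact Hdf).
  apply is_derive_unique in Hdf.
  destruct k as [|[|[|[|[|k]]]]]; destruct nu as [|[|[|[|[|nu]]]]];
    destruct mu as [|[|[|[|[|mu]]]]];
    try reflexivity; cbn [partial EH_frame vec EH_frame_jacobian];
    try apply Derive_const; try exact Hdf;
    apply is_derive_unique; auto_derive;
    try (repeat split; nonzero);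
    try change (Derive (fun x => EH_f A B x) r) with (Derive (EH_f A B) r);
    rewrite ?Hdf; field [Hc]; repeat split; nonzero.
Qed.

Lemma sum_1_4 (G : AbelianMonoid) (a : nat -> G) :
  sum_n_m a 1 4 = plus (plus (plus (a 1%nat) (a 2%nat)) (a 3%nat)) (a 4%nat).
Proof.
  rewrite (sum_n_Sm a 1 3), (sum_n_Sm a 1 2), (sum_n_Sm a 1 1), sum_n_n by lia.
  reflexivity.
Qed.

Lemma sum_1_4_R (a : nat -> R) :
  sum_n_m a 1 4 = a 1%nat + a 2%nat + a 3%nat + a 4%nat.
Proof. exact (sum_1_4 R_AbelianMonoid a). Qed.

(** The coefficients of [[e_i, e_j] = sum_k c_ijk e_k]. *)
Definition EH_structure (A B r : R) (i j k : nat) : R :=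
  let f := EH_f A B r in
  let f' := EH_df A B r in
  match i, j, k with
  | 1%nat, 2%nat, 2%nat | 1%nat, 3%nat, 3%nat => - (f / r)
  | 2%nat, 1%nat, 2%nat | 3%nat, 1%nat, 3%nat => f / r
  | 1%nat, 4%nat, 4%nat => - (f / r + f')
  | 4%nat, 1%nat, 4%nat => f / r + f'
  | 2%nat, 3%nat, 4%nat => - (2 * f / r)
  | 3%nat, 2%nat, 4%nat => 2 * f / r
  | 3%nat, 4%nat, 2%nat | 4%nat, 2%nat, 3%nat => - (2 / (r * f))
  | 4%nat, 3%nat, 2%nat | 2%nat, 4%nat, 3%nat => 2 / (r * f)
  | _, _, _ => 0
  end.

Definition frame_index (i : nat) : Prop := (1 <= i <= 4)%nat.

Ltac frame_cases i :=
  destruct i as [|[|[|[|[|i]]]]]; unfold frame_index in *; try (exfalso; lia).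

Lemma EH_frame_bracket A B r theta phi psi i j nu :
  EH_regular A B (r, theta, phi, psi) ->
  frame_index i -> frame_index j -> frame_index nu ->
  bracket (EH_frame A B i) (EH_frame A B j) (r, theta, phi, psi) nu
  = sum_n_m (fun k => EH_structure A B r i j k *
                      EH_frame A B k (r, theta, phi, psi) nu) 1 4.
Proof.
  intros Hreg Hi Hj Hnu. unfold bracket, dir. rewrite !sum_1_4_R.
  rewrite !EH_frame_partial by exact Hreg.
  destruct Hreg as (Hr & HW & Hs).
  pose proof (EH_f_pos _ _ _ HW) as Hf.
  pose proof (cos_sqr theta) as Hc.
  pose proof (cos_sqr psi) as Hcp.
  frame_cases i; frame_cases j; frame_cases nu;
    cbn [EH_frame EH_frame_jacobian EH_structure vec];
    try ring.
  all: field [Hc Hcp]; repeat split; nonzero.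
Qed.

Definition kronecker (i j : nat) : R := if Nat.eqb i j then 1 else 0.

Lemma EH_frame_orthonormal A B p i j :
  EH_regular A B p -> frame_index i -> frame_index j ->
  pairing (EH_metric A B) (EH_frame A B i) (EH_frame A B j) p = kronecker i j.
Proof.
  destruct p as [[[r theta] phi] psi]. intros (Hr & HW & Hs) Hi Hj.
  pose proof (EH_f_pos _ _ _ HW) as Hf.
  pose proof (cos_sqr theta) as Hc.
  pose proof (cos_sqr psi) as Hcp.
  unfold pairing, EH_metric. fold (EH_W A B r). rewrite <- (EH_f_sqr _ _ _ HW).
  frame_cases i; frame_cases j;
    unfold sigma1, sigma2, sigma3; cbn [EH_frame vec kronecker Nat.eqb];
    field [Hc Hcp]; repeat split; nonzero.
Qed.

(** * The Levi-Civita connection in the frame *)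

Lemma locally_pos (f : R -> R) (x : R) :
  ex_derive f x -> 0 < f x -> locally x (fun y => 0 < f y).
Proof.
  intros Hf Hx. apply (ex_derive_continuous f x Hf). exact (open_gt 0 _ Hx).
Qed.

(** The regular region is open along every coordinate line, so functions that are
    constant only there, such as the pairings of the frame fields, still have
    zero partial derivatives. *)
Lemma partial_locally_constant A B (h : point -> R) (c : R) mu p :
  (forall q, EH_regular A B q -> h q = c) ->
  EH_regular A B p -> partial mu h p = 0.
Proof.
  destruct p as [[[r theta] phi] psi]. intros Hh (Hr & HW & Hs).
  destruct mu as [|[|[|[|[|mu]]]]]; try reflexivity; cbn [partial];
    rewrite <- (Derive_const c) at 1; apply Derive_ext_loc.
  - apply (filter_imp (fun x => 0 < x /\ 0 < EH_W A B x)).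
    + intros x [Hx HWx]. apply Hh. easy.
    + apply filter_and; apply locally_pos; trivial.
      * apply ex_derive_id.
      * unfold EH_W. auto_derive. repeat split; nonzero.
  - apply (filter_imp (fun x => 0 < sin x)).
    + intros x Hx. apply Hh. easy.
    + apply locally_pos; trivial. auto_derive. exact I.
  - apply filter_forall. intros x. apply Hh. easy.
  - apply filter_forall. intros x. apply Hh. easy.
Qed.

(** Linearity of the metric in its first argument. Vectors are compared at the
    indices 1 to 4 only, as the other values of an index family have no
    meaning. *)
Lemma EH_metric_combination A B p (X Z : nat -> R) (c : nat -> R)
    (E : nat -> nat -> R) :
  (forall nu, frame_index nu -> X nu = sum_n_m (fun k => c k * E k nu) 1 4) ->
  EH_metric A B p X Z = sum_n_m (fun k => c k * EH_metric A B p (E k) Z) 1 4.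
Proof.
  destruct p as [[[r theta] phi] psi]. intros HX. rewrite sum_1_4_R.
  unfold EH_metric, sigma1, sigma2, sigma3.
  rewrite (HX 1%nat), (HX 2%nat), (HX 3%nat), (HX 4%nat)
    by (unfold frame_index; lia).
  rewrite !sum_1_4_R. ring.
Qed.

Lemma sum_kronecker (c : nat -> R) j :
  frame_index j -> sum_n_m (fun k => c k * kronecker k j) 1 4 = c j.
Proof.
  intros Hj. rewrite sum_1_4_R. frame_cases j; cbn; ring.
Qed.

Lemma EH_bracket_pairing A B r theta phi psi i j k :
  EH_regular A B (r, theta, phi, psi) ->
  frame_index i -> frame_index j -> frame_index k ->
  pairing (EH_metric A B) (bracket (EH_frame A B i) (EH_frame A B j))
    (EH_frame A B k) (r, theta, phi, psi) = EH_structure A B r i j k.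
Proof.
  intros Hreg Hi Hj Hk. unfold pairing.
  rewrite (EH_metric_combination A B _ _ _ (EH_structure A B r i j)
             (fun l => EH_frame A B l (r, theta, phi, psi)))
    by (intros nu Hnu; apply EH_frame_bracket; assumption).
  rewrite <- (sum_kronecker (EH_structure A B r i j) k Hk), !sum_1_4_R.
  repeat f_equal; apply (EH_frame_orthonormal A B (r, theta, phi, psi));
    unfold frame_index; trivial; lia.
Qed.

(** In the Koszul formula the first three terms vanish, because they differentiate
    the constant pairings of an orthonormal frame. *)
Lemma EH_levi_civita A B r theta phi psi i j k :
  EH_regular A B (r, theta, phi, psi) ->
  frame_index i -> frame_index j -> frame_index k ->
  levi_civita (EH_metric A B) (EH_frame A B i) (EH_frame A B j) (EH_frame A B k)
    (r, theta, phi, psi)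
  = / 2 * (EH_structure A B r i j k - EH_structure A B r i k j
           - EH_structure A B r j k i).
Proof.
  intros Hreg Hi Hj Hk.
  assert (H0 : forall X a b, frame_index a -> frame_index b ->
    dir X (pairing (EH_metric A B) (EH_frame A B a) (EH_frame A B b))
      (r, theta, phi, psi) = 0).
  { intros X a b Ha Hb. unfold dir. rewrite sum_1_4_R.
    rewrite !(partial_locally_constant A B _ (kronecker a b)); trivial; try ring;
      intros q Hq; apply EH_frame_orthonormal; trivial. }
  unfold levi_civita. rewrite !H0, !EH_bracket_pairing by assumption. ring.
Qed.

(** * The spin connection and the Dirac operator *)

(** Clifford multiplication on the list of components, freed from the dependent
    type of matrices. *)
Definition clifford_action (k : nat) (s : nat -> C) (i : nat) : C :=
  let s0 := s 0%nat in
  let s1 := s 1%nat in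
  let s2 := s 2%nat in
  let s3 := s 3%nat in
  let quadruple (a b c d : C) : C :=
    match i with
    | 0%nat => a
    | 1%nat => b
    | 2%nat => c
    | 3%nat => d
    | _ => 0%C
    end in
  match k with
  | 1%nat => quadruple s2 s3 (- s0)%C (- s1)%C
  | 2%nat => quadruple (Ci * s3)%C (Ci * s2)%C (Ci * s1)%C (Ci * s0)%C
  | 3%nat => quadruple (- s3)%C s2 (- s1)%C s0
  | 4%nat => quadruple (Ci * s2)%C (- (Ci * s3))%C (Ci * s0)%C (- (Ci * s1))%C
  | _ => 0%C
  end.

Definition component (s : spinor) (i : nat) : C := coeff_mat (RtoC 0) s i 0.

Definition component_index (i : nat) : Prop := (i < 4)%nat.

Lemma component_cmul k s i :
  component_index i -> component (cmul k s) i = clifford_action k (component s) i.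
Proof.
  intros Hi. unfold component at 1, cmul, Mmult.
  rewrite coeff_mat_bij by (try exact Hi; lia).
  cbn [Nat.pred]. rewrite !sum_Sn, sum_O.
  destruct i as [|[|[|[|i]]]]; try (unfold component_index in Hi; exfalso; lia);
    destruct k as [|[|[|[|[|k]]]]]; cbn -[Cplus Cmult Copp Ci RtoC];
    ring.
Qed.

Lemma clifford_action_ext k s t i :
  (forall j, component_index j -> s j = t j) ->
  clifford_action k s i = clifford_action k t i.
Proof.
  intros H. unfold clifford_action, component_index in *.
  rewrite !H by lia. reflexivity.
Qed.

Lemma sum_1_4_C (a : nat -> C) :
  sum_n_m (G := C_AbelianMonoid) a 1 4 = (a 1%nat + a 2%nat + a 3%nat + a 4%nat)%C.
Proof. exact (sum_1_4 C_AbelianMonoid a). Qed.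

(** The zeroth-order part of the covariant derivative along [e_k]; the
    frame is parallel along [e1]. *)
Definition EH_connection_term (A B r : R) (k : nat) (s : nat -> C) (i : nat) : C :=
  let f := EH_f A B r in
  let f' := EH_df A B r in
  let product a b := clifford_action a (clifford_action b s) i in
  match k with
  | 2%nat => (RtoC (f / (2 * r)) * (product 1%nat 2%nat - product 3%nat 4%nat))%C
  | 3%nat => (RtoC (f / (2 * r)) * (product 1%nat 3%nat + product 2%nat 4%nat))%C
  | 4%nat => (RtoC (/ 2) * (RtoC (f / r + f') * product 1%nat 4%nat
                + RtoC (f / r - 2 / (r * f)) * product 2%nat 3%nat))%C
  | _ => 0%C
  end.

Lemma EH_spin_connection A B r theta phi psi k Phi i :
  EH_regular A B (r, theta, phi, psi) -> frame_index k -> component_index i ->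
  component (spin_connection (EH_metric A B) (EH_frame A B) k Phi
               (r, theta, phi, psi)) i
  = (dirC (EH_frame A B k) (fun q => component (Phi q) i) (r, theta, phi, psi)
     + EH_connection_term A B r k (component (Phi (r, theta, phi, psi))) i)%C.
Proof.
  intros Hreg Hk Hi. unfold component at 1, spin_connection, Mplus, spinor_dir, Mscal.
  unfold component_index in Hi.
  rewrite !coeff_mat_bij by lia.
  change (@plus C_AbelianMonoid) with Cplus. apply f_equal.
  unfold spinor_sum.
  rewrite !coeff_mat_bij by lia. rewrite !sum_1_4_C.
  rewrite !coeff_mat_bij by lia. rewrite !sum_1_4_C.
  rewrite !coeff_mat_bij by lia.
  rewrite !EH_levi_civita by (unfold frame_index in *; trivial; lia).
  set (s := Phi (r, theta, phi, psi)).
  assert (Hprod : forall a b, coeff_mat (RtoC 0) (cmul a (cmul b s)) i 0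
            = clifford_action a (clifford_action b (component s)) i).
  { intros a b. fold (component (cmul a (cmul b s)) i).
    rewrite component_cmul by exact Hi.
    apply clifford_action_ext. intros j Hj. apply component_cmul, Hj. }
  rewrite !Hprod. clear Hprod.
  pose proof (EH_f_pos _ _ _ (proj1 (proj2 Hreg))) as Hf.
  pose proof (proj1 Hreg) as Hr.
  frame_cases k; destruct i as [|[|[|[|i]]]]; try (exfalso; lia);
  cbn [EH_structure EH_connection_term clifford_action];
  generalize (component s 0) (component s 1) (component s 2) (component s 3);
  intros s0 s1 s2 s3;
  apply injective_projections; cbn; field; lra.
Qed.

(** The rows of the Dirac operator on a spinor with components [s], where [D k j]
    stands for the derivative of the [j]-th component along [e_k]. The first-order
    terms in [e2] and [e3] are grouped, since they act as one complex operator.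
    The term [h] collects the products [e_k . e_1 . e_k = e_1], hence is half the
    trace of the second fundamental form of the level sets of [r]; [kappa]
    collects the multiples of [- e2 . e3 . e4], which is the identity between the
    blocks. *)
Definition EH_dirac_component (A B r : R) (D : nat -> nat -> C) (s : nat -> C)
    (i : nat) : C :=
  let f := EH_f A B r in
  let h := 3 * f / (2 * r) + EH_df A B r / 2 in
  let kappa := f / (2 * r) + 1 / (r * f) in
  match i with
  | 0%nat => D 1%nat 2%nat + RtoC (h + kappa) * s 2%nat
             + (Ci * D 2%nat 3%nat - D 3%nat 3%nat) + Ci * D 4%nat 2%nat
  | 1%nat => D 1%nat 3%nat + RtoC (h + kappa) * s 3%nat
             + (Ci * D 2%nat 2%nat + D 3%nat 2%nat) - Ci * D 4%nat 3%nat
  | 2%nat => - D 1%nat 0%nat - RtoC (h - kappa) * s 0%nat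
             + (Ci * D 2%nat 1%nat - D 3%nat 1%nat) + Ci * D 4%nat 0%nat
  | 3%nat => - D 1%nat 1%nat - RtoC (h - kappa) * s 1%nat
             + (Ci * D 2%nat 0%nat + D 3%nat 0%nat) - Ci * D 4%nat 1%nat
  | _ => 0
  end%C.

Lemma EH_dirac A B r theta phi psi Phi i :
  EH_regular A B (r, theta, phi, psi) -> component_index i ->
  component (dirac (EH_metric A B) (EH_frame A B) Phi (r, theta, phi, psi)) i
  = EH_dirac_component A B r
      (fun k j => dirC (EH_frame A B k) (fun q => component (Phi q) j)
                    (r, theta, phi, psi))
      (component (Phi (r, theta, phi, psi))) i.
Proof.
  intros Hreg Hi. unfold component at 1, dirac, spinor_sum.
  rewrite coeff_mat_bij by (try exact Hi; lia). rewrite sum_1_4_C.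
  pose proof (EH_f_pos _ _ _ (proj1 (proj2 Hreg))) as Hf.
  pose proof (proj1 Hreg) as Hr.
  assert (H : forall k, frame_index k ->
      coeff_mat (RtoC 0) (cmul k (spin_connection (EH_metric A B) (EH_frame A B) k
        Phi (r, theta, phi, psi))) i 0
      = clifford_action k (fun j =>
          (dirC (EH_frame A B k) (fun q => component (Phi q) j) (r, theta, phi, psi)
           + EH_connection_term A B r k (component (Phi (r, theta, phi, psi))) j)%C) i).
  { intros k Hk.
    fold (component (cmul k (spin_connection (EH_metric A B) (EH_frame A B) k
        Phi (r, theta, phi, psi))) i).
    rewrite component_cmul by exact Hi.
    apply clifford_action_ext. intros j Hj. apply EH_spin_connection; assumption. }
  rewrite !H by (unfold frame_index; lia). clear H.
  set (s := Phi (r, theta, phi, psi)).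
  unfold component_index in Hi.
  destruct i as [|[|[|[|i]]]]; try (exfalso; lia);
    cbn [EH_connection_term EH_dirac_component clifford_action];
    repeat match goal with |- context [dirC (EH_frame A B ?k) ?h ?p] =>
      generalize (dirC (EH_frame A B k) h p); intros ? end;
    generalize (component s 0) (component s 1) (component s 2) (component s 3);
    intros s0 s1 s2 s3;
    apply injective_projections; cbn; field; lra.
Qed.

(** * Logarithmic derivatives and modes *)

(** [f' = a f] rather than [f' / f = a]: division is avoided, and the relation is
    the eigenvalue equation that separation of variables needs. *)
Definition is_log_derive (f : R -> R) (x a : R) : Prop := is_derive f x (a * f x).

Lemma is_log_derive_mult f g x a b :
  is_log_derive f x a -> is_log_derive g x b ->
  is_log_derive (fun y => f y * g y) x (a + b).
Proof.
  unfold is_log_derive. intros Hf Hg.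
  replace ((a + b) * (f x * g x)) with (a * f x * g x + f x * (b * g x)) by ring.
  exact (is_derive_mult f g x _ _ Hf Hg Rmult_comm).
Qed.

Lemma is_log_derive_Rpower g dg e x :
  is_derive g x dg -> 0 < g x ->
  is_log_derive (fun y => Rpower (g y) e) x (e * (dg / g x)).
Proof.
  unfold is_log_derive, Rpower. intros Hg Hx.
  auto_derive.
  - repeat split; trivial. eexists; exact Hg.
  - replace (Derive (fun y => g y) x) with dg
      by (symmetry; apply is_derive_unique, Hg).
    field. lra.
Qed.

(** The arrangement of the factors is that of the entries of [EH_spinor], whose
    components are therefore modes by conversion. *)
Definition mode (N mu : R) (c : C) (u v : R -> R) : point -> C := fun p =>
  let '(r, theta, phi, psi) := p in
  (expi (N * phi) * (c * expi (mu * psi) * u r * v theta))%C.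

(** Each coordinate derivative multiplies a mode by a scalar: [a], [b], [i N] and
    [i mu] respectively. *)
Lemma dirC_mode N mu c u v a b X r theta phi psi :
  is_log_derive u r a -> is_log_derive v theta b ->
  let p := (r, theta, phi, psi) in
  dirC X (mode N mu c u v) p
  = ((X p 1%nat * a + X p 2%nat * b, X p 3%nat * N + X p 4%nat * mu)%R
     * mode N mu c u v p)%C.
Proof.
  intros Hu Hv p. unfold dirC, dir. rewrite !sum_1_4_R.
  subst p. unfold is_log_derive in *.
  assert (Hu' : ex_derive u r) by (eexists; exact Hu).
  assert (Hv' : ex_derive v theta) by (eexists; exact Hv).
  apply is_derive_unique in Hu. apply is_derive_unique in Hv.
  assert (H1 : forall g dg x, is_derive g x dg -> Derive g x = dg)
    by (intros; apply is_derive_unique; assumption).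
  destruct c as [c1 c2].
  generalize (X (r, theta, phi, psi)). clear X. intros X.
  cbn [partial]. unfold mode, expi. cbn.
  (* [u] and [v] stay abstract: automatic differentiation leaves their derivatives
     in place, and these must not be differentiated again. *)
  repeat match goal with |- context [Derive ?g ?x] =>
    lazymatch g with
    | (fun x => u x) => fail | (fun x => v x) => fail | _ => idtac
    end;
    erewrite (H1 g _ x) by (auto_derive; [ repeat split; trivial | reflexivity ])
  end.
  change (fun x : R => u x) with u. change (fun x : R => v x) with v.
  rewrite !Hu, !Hv.
  apply injective_projections; cbn; ring.
Qed.

Lemma dirC_ext X h1 h2 p : (forall q, h1 q = h2 q) -> dirC X h1 p = dirC X h2 p.
Proof.
  intros H. unfold dirC, dir. destruct p as [[[r theta] phi] psi].
  apply f_equal2; rewrite !sum_1_4_R; cbn [partial];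
    repeat apply (f_equal2 Rplus); apply (f_equal2 Rmult); trivial;
    apply Derive_ext; intros; now rewrite H.
Qed.

(** * The separated Dirac equation *)

(** The sign in the equations of a component: the matrix [M4] is [i] times
    [diag(1, -1)], and [i D2 + D3] acts on even components where [i D2 - D3] acts
    on odd ones. *)
Definition spin_sign (j : nat) : R := (-1) ^ j.

(** What is left of the Dirac equation for the [j]-th component when the angular
    terms cancel: [a] is the logarithmic derivative of its radial factor and [mu]
    its frequency in [psi]. *)
Definition radial_equation (A B r : R) (j : nat) (a mu : R) : Prop :=
  let f := EH_f A B r in
  let f' := EH_df A B r in
  let q := (1 - 2 * spin_sign j * mu) / (r * f) in
  match j with
  | 0%nat | 1%nat => f * a + f / r + f' / 2 - q = 0
  | _ => f * a + 2 * f / r + f' / 2 + q = 0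
  end.

(** The condition that [i D2] plus [spin_sign j] times [D3], for the derivatives
    along [e2] and [e3], annihilates a mode: [b] is the logarithmic derivative of
    the factor in [theta]. *)
Definition angular_equation (theta : R) (j : nat) (b N mu : R) : Prop :=
  b * sin theta = spin_sign j * (N - mu * cos theta).

(** A row of the Dirac operator involves two components, one through [e1], [e4] and
    the zeroth-order terms and the other only through [e2] and [e3]; the radial
    equation of the former and the angular equation of the latter make both
    contributions vanish. *)
Lemma EH_dirac_modes A B r theta phi psi Phi N
    (mu : nat -> R) (c : nat -> C) (u v : nat -> R -> R) (a b : nat -> R) i :
  EH_regular A B (r, theta, phi, psi) ->
  (forall j q, component_index j ->
     component (Phi q) j = mode N (mu j) (c j) (u j) (v j) q) ->
  (forall j, component_index j -> is_log_derive (u j) r (a j)) ->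
  (forall j, component_index j -> is_log_derive (v j) theta (b j)) ->
  (forall j, component_index j -> radial_equation A B r j (a j) (mu j)) ->
  (forall j, component_index j -> angular_equation theta j (b j) N (mu j)) ->
  component_index i ->
  component (dirac (EH_metric A B) (EH_frame A B) Phi (r, theta, phi, psi)) i = 0.
Proof.
  intros Hreg HPhi Hu Hv Ha Hb Hi. rewrite EH_dirac by assumption.
  pose (X := fun k => EH_frame A B k (r, theta, phi, psi)).
  pose (lambda := fun k j => ((X k 1%nat * a j + X k 2%nat * b j)%R,
                             (X k 3%nat * N + X k 4%nat * mu j)%R) : C).
  assert (Hdir : forall k j, component_index j ->
    dirC (EH_frame A B k) (fun q => component (Phi q) j) (r, theta, phi, psi)
    = (lambda k j * component (Phi (r, theta, phi, psi)) j)%C).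
  { intros k j Hj. rewrite HPhi by exact Hj. unfold lambda, X.
    rewrite <- (dirC_mode N (mu j) (c j) (u j) (v j) (a j) (b j)) by auto.
    apply dirC_ext. intros q. apply HPhi, Hj. }
  generalize (component (Phi (r, theta, phi, psi))) Hdir. clear Hdir. intros s Hdir.
  pose proof (EH_f_pos _ _ _ (proj1 (proj2 Hreg))) as Hf.
  destruct Hreg as (Hr & HW & Hs).
  assert (Hang : forall j, component_index j ->
    (Ci * lambda 2%nat j + RtoC (spin_sign j) * lambda 3%nat j)%C = 0).
  { intros j Hj. specialize (Hb j Hj). unfold angular_equation in Hb.
    assert (Hbj : b j = spin_sign j * (N - mu j * cos theta) / sin theta)
      by (rewrite <- Hb; field; lra).
    assert (Hsq : spin_sign j ^ 2 = 1).
    { unfold spin_sign. rewrite <- pow_mult, Nat.mul_comm. apply pow_1_even. }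
    unfold lambda, X. rewrite Hbj. cbn [EH_frame vec].
    generalize (spin_sign j) Hsq. intros e He.
    apply injective_projections; cbn; field [He]; lra. }
  assert (Hrad : forall j, component_index j -> let e := spin_sign j in
    match j with
    | 0%nat | 1%nat =>
        (- lambda 1%nat j
           - RtoC (EH_f A B r / r + EH_df A B r / 2 - 1 / (r * EH_f A B r))
           + RtoC e * (Ci * lambda 4%nat j))%C = 0
    | _ =>
        (lambda 1%nat j
           + RtoC (2 * EH_f A B r / r + EH_df A B r / 2 + 1 / (r * EH_f A B r))
           + RtoC e * (Ci * lambda 4%nat j))%C = 0
    end).
  { intros j Hj. specialize (Ha j Hj). unfold radial_equation in Ha.
    unfold component_index in Hj. unfold lambda, X. cbn [EH_frame vec].
    destruct j as [|[|j]]; cbn [spin_sign pow] in Ha |- *;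
      match type of Ha with ?E = 0 =>
        apply injective_projections; cbn;
        [ first [ transitivity E; [ field; lra | exact Ha ]
                | transitivity (- E); [ field; lra | rewrite Ha; ring ] ]
        | ring ]
      end. }
  unfold component_index in *.
  assert (Hcombine : forall x y z w : C, x = 0 -> y = 0 -> (x * z + y * w = 0)%C)
    by (intros x y z w -> ->; ring).
  assert (Hj : (0 < 4 /\ 1 < 4 /\ 2 < 4 /\ 3 < 4)%nat) by lia.
  destruct Hj as (H0 & H1 & H2 & H3).
  destruct i as [|[|[|[|i]]]]; try (exfalso; lia); cbn [EH_dirac_component];
    rewrite !Hdir by lia;
    [ rewrite <- (Hcombine _ _ (s 2%nat) (s 3%nat) (Hrad 2%nat H2) (Hang 3%nat H3))
    | rewrite <- (Hcombine _ _ (s 3%nat) (s 2%nat) (Hrad 3%nat H3) (Hang 2%nat H2))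
    | rewrite <- (Hcombine _ _ (s 0%nat) (s 1%nat) (Hrad 0%nat H0) (Hang 1%nat H1))
    | rewrite <- (Hcombine _ _ (s 1%nat) (s 0%nat) (Hrad 1%nat H1) (Hang 0%nat H0)) ];
    clearbody lambda; apply injective_projections; cbn; field; lra.
Qed.

(** * The explicit radial and angular factors *)

(** The substitution of [(- m, - n - 1)] for [(m, n)] turns the frequencies of the
    first and third components into the negatives of those of the second and
    fourth, and the factors of the former into the factors of the latter. Only the
    first and third components have to be computed. *)
Lemma u2_eq_u1 d m r0 r : u2 d m r0 r = u1 d (- m) r0 r.
Proof. unfold u1, u2. do 3 f_equal; try ring; do 2 f_equal; ring. Qed.

Lemma u4_eq_u3 d m r0 r : u4 d m r0 r = u3 d (- m) r0 r.
Proof.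
  unfold u3, u4.
  replace (1 - d - d * - m) with (1 - d + d * m) by ring.
  replace (1 + 2 * - m) with (1 - 2 * m) by ring. reflexivity.
Qed.

Lemma v2_eq_v1 d m n theta : v2 d m n theta = v1 d (- m) (- n - 1) theta.
Proof. unfold v1, v2. f_equal; f_equal; lra. Qed.

Definition u1_log_derivative (d m r0 r : R) : R :=
  (1 - d - d * m) / (2 * d) * (2 * r / (r ^ 2 - r0 ^ 2))
  + (- ((1 - d - d * m) / (2 * d)) - d * (1 + 2 * m) / 4)
    * (2 * r / (r ^ 2 + (d - 1) * r0 ^ 2)).

Definition u3_log_derivative (d m r0 r : R) : R :=
  - (1 / r)
  + (- (1 / 2) - (1 - d - d * m) / (2 * d)) * (2 * r / (r ^ 2 - r0 ^ 2))
  + (- (1 / 2) + (1 - d - d * m) / (2 * d) + d * (1 + 2 * m) / 4)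
    * (2 * r / (r ^ 2 + (d - 1) * r0 ^ 2)).

Lemma is_log_derive_u1 d m r0 r :
  0 < r ^ 2 - r0 ^ 2 -> 0 < r ^ 2 + (d - 1) * r0 ^ 2 ->
  is_log_derive (u1 d m r0) r (u1_log_derivative d m r0 r).
Proof.
  intros Hx Hy.
  apply is_log_derive_mult;
    [ apply (is_log_derive_Rpower (fun r => r ^ 2 - r0 ^ 2))
    | apply (is_log_derive_Rpower (fun r => r ^ 2 + (d - 1) * r0 ^ 2)) ];
    trivial; auto_derive; trivial; ring.
Qed.

Lemma is_log_derive_u3 d m r0 r :
  0 < r -> 0 < r ^ 2 - r0 ^ 2 -> 0 < r ^ 2 + (d - 1) * r0 ^ 2 ->
  is_log_derive (u3 d m r0) r (u3_log_derivative d m r0 r).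
Proof.
  intros Hr Hx Hy.
  apply is_log_derive_mult; [ apply is_log_derive_mult | ].
  - unfold is_log_derive. auto_derive; [ lra | field; lra ].
  - apply (is_log_derive_Rpower (fun r => r ^ 2 - r0 ^ 2));
      trivial; auto_derive; trivial; ring.
  - apply (is_log_derive_Rpower (fun r => r ^ 2 + (d - 1) * r0 ^ 2));
      trivial; auto_derive; trivial; ring.
Qed.

Lemma half_angle_pos theta :
  0 < theta < PI -> 0 < sin (theta / 2) /\ 0 < cos (theta / 2).
Proof.
  intros H. split; [ apply sin_gt_0 | apply cos_gt_0 ]; lra.
Qed.

(** The exponents [N - mu] of the sine and [- N - mu] of the cosine give
    [((N - mu) cos^2 + (N + mu) sin^2) / (2 sin cos)] at half the angle, which the
    double angle formulas turn into [(N - mu cos theta) / sin theta]. *)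
Lemma is_log_derive_v1 d m n theta :
  0 < theta < PI ->
  is_log_derive (v1 d m n) theta
    ((n + 1 / 2 - d / 2 * (m + 1 / 2) * cos theta) / sin theta).
Proof.
  intros Ht. destruct (half_angle_pos _ Ht) as [Hs Hc].
  pose proof (cos_sqr (theta / 2)) as Hsq.
  replace ((n + 1 / 2 - d / 2 * (m + 1 / 2) * cos theta) / sin theta) with
    ((n + 1 / 2 - d / 2 * (m + 1 / 2)) * (cos (theta / 2) / 2 / sin (theta / 2))
     + (- n - 1 / 2 - d / 2 * (m + 1 / 2))
       * (- sin (theta / 2) / 2 / cos (theta / 2))).
  - apply is_log_derive_mult;
      [ apply (is_log_derive_Rpower (fun t => sin (t / 2)))
      | apply (is_log_derive_Rpower (fun t => cos (t / 2))) ];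
      trivial; auto_derive; trivial; unfold Rdiv; field.
  - replace (sin theta) with (2 * sin (theta / 2) * cos (theta / 2))
      by (rewrite <- sin_2a; f_equal; field).
    replace (cos theta) with (cos (theta / 2) * cos (theta / 2)
                              - sin (theta / 2) * sin (theta / 2))
      by (rewrite <- cos_2a; f_equal; field).
    field [Hsq]. lra.
Qed.

Lemma is_log_derive_ext f g x a :
  (forall y, f y = g y) -> is_log_derive f x a -> is_log_derive g x a.
Proof.
  unfold is_log_derive. intros H. rewrite H. apply is_derive_ext, H.
Qed.

Lemma EH_W_factor d r0 r :
  r <> 0 ->
  EH_W (- ((d - 2) / 2 * r0 ^ 2)) ((d - 1) * r0 ^ 4) r
  = (r ^ 2 - r0 ^ 2) * (r ^ 2 + (d - 1) * r0 ^ 2) / r ^ 4.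
Proof. intros H. unfold EH_W. field. exact H. Qed.

(** Multiplied by [r f], the radial equation contains only [f^2] and
    [r f f' / 2 = A / r^2 + B / r^4], which are rational functions of [r]. *)
Lemma radial_equation_intro A B r j a mu :
  0 < r -> 0 < EH_W A B r ->
  let q := 1 - 2 * spin_sign j * mu in
  match j with
  | 0%nat | 1%nat => EH_W A B r * (a * r + 1) + A / r ^ 2 + B / r ^ 4 = q
  | _ => EH_W A B r * (a * r + 2) + A / r ^ 2 + B / r ^ 4 = - q
  end ->
  radial_equation A B r j a mu.
Proof.
  intros Hr HW q H. unfold radial_equation. fold q.
  pose proof (EH_f_pos _ _ _ HW) as Hf.
  rewrite <- (EH_f_sqr _ _ _ HW) in H. unfold EH_df.
  generalize dependent (EH_f A B r). intros f H Hf.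
  destruct j as [|[|j]];
    [ rewrite <- H | rewrite <- H | rewrite <- (Ropp_involutive q), <- H ];
    field; lra.
Qed.

Lemma radial_identity_u1 d m r0 r :
  d <> 0 -> r <> 0 -> r ^ 2 - r0 ^ 2 <> 0 -> r ^ 2 + (d - 1) * r0 ^ 2 <> 0 ->
  let A := - ((d - 2) / 2 * r0 ^ 2) in
  let B := (d - 1) * r0 ^ 4 in
  EH_W A B r * (u1_log_derivative d m r0 r * r + 1) + A / r ^ 2 + B / r ^ 4
  = 1 - 2 * (d / 2 * (m + 1 / 2)).
Proof.
  intros Hd Hr Hx Hy A B. unfold A, B. rewrite EH_W_factor by exact Hr.
  unfold u1_log_derivative. field. auto.
Qed.

Lemma radial_identity_u3 d m r0 r :
  d <> 0 -> r <> 0 -> r ^ 2 - r0 ^ 2 <> 0 -> r ^ 2 + (d - 1) * r0 ^ 2 <> 0 ->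
  let A := - ((d - 2) / 2 * r0 ^ 2) in
  let B := (d - 1) * r0 ^ 4 in
  EH_W A B r * (u3_log_derivative d m r0 r * r + 2) + A / r ^ 2 + B / r ^ 4
  = - (1 - 2 * (d / 2 * (m + 1 / 2))).
Proof.
  intros Hd Hr Hx Hy A B. unfold A, B. rewrite EH_W_factor by exact Hr.
  unfold u3_log_derivative. field. auto.
Qed.

(** * Differentiability *)

(** The product norm on [point]. A notation rather than a constant, so that it is
    transparent to unification. *)
Notation point_space :=
  (prod_NormedModule _ (prod_NormedModule _ (prod_NormedModule _
     R_NormedModule R_NormedModule) R_NormedModule) R_NormedModule).

Definition differentiable (h : point -> R) (p : point) : Prop :=
  ex_filterdiff (K := R_AbsRing) (U := point_space) (V := R_NormedModule)
    h (locally p).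

Lemma differentiable_plus h k p :
  differentiable h p -> differentiable k p ->
  differentiable (fun q => h q + k q) p.
Proof.
  intros Hh Hk.
  apply (ex_filterdiff_comp'_2 h k (fun x y : R => x + y)); trivial.
  apply ex_filterdiff_linear. exact (is_linear_plus (V := R_NormedModule)).
Qed.

Lemma differentiable_mult h k p :
  differentiable h p -> differentiable k p ->
  differentiable (fun q => h q * k q) p.
Proof.
  intros [lh Hh] [lk Hk]. eexists.
  apply (filterdiff_mult_fct (K := R_AbsRing) h k p lh lk Rmult_comm Hh Hk).
Qed.

Lemma differentiable_const c p : differentiable (fun _ => c) p.
Proof. eexists. apply filterdiff_const. Qed.

Lemma differentiable_comp (g : R -> R) h p :
  ex_derive g (h p) -> differentiable h p -> differentiable (fun q => g (h q)) p.
Proof.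
  intros Hg Hh. apply (ex_filterdiff_comp' h g p Hh).
  apply (proj1 (ex_derive_filterdiff g (h p))), Hg.
Qed.

Definition differentiableC (h : point -> C) (p : point) : Prop :=
  differentiable (fun q => Re (h q)) p /\ differentiable (fun q => Im (h q)) p.

Lemma differentiableC_mult h k p :
  differentiableC h p -> differentiableC k p ->
  differentiableC (fun q => h q * k q)%C p.
Proof.
  intros [Hh Hh'] [Hk Hk'].
  assert (Hopp : differentiable (fun q => -1 * (Im (h q) * Im (k q))) p)
    by (apply differentiable_mult; [ apply differentiable_const | ];
        apply differentiable_mult; assumption).
  split.
  - pose proof (differentiable_plus _ _ p (differentiable_mult _ _ p Hh Hk) Hopp) as H.
    revert H. apply ex_filterdiff_ext. intros q. unfold Cmult, Re, Im. simpl. ring.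
  - exact (differentiable_plus _ _ p (differentiable_mult _ _ p Hh Hk')
             (differentiable_mult _ _ p Hh' Hk)).
Qed.

Lemma differentiable_r p : differentiable (fun q => fst (fst (fst q))) p.
Proof.
  apply ex_filterdiff_linear.
  exact (is_linear_comp _ _ (is_linear_comp _ _ is_linear_fst is_linear_fst)
           is_linear_fst).
Qed.

Lemma differentiable_theta p : differentiable (fun q => snd (fst (fst q))) p.
Proof.
  apply ex_filterdiff_linear.
  exact (is_linear_comp _ _ (is_linear_comp _ _ is_linear_fst is_linear_fst)
           is_linear_snd).
Qed.

Lemma differentiable_phi p : differentiable (fun q => snd (fst q)) p.
Proof.
  apply ex_filterdiff_linear.
  exact (is_linear_comp _ _ is_linear_fst is_linear_snd).
Qed.

Lemma differentiable_psi p : differentiable (fun q => snd q) p.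
Proof. apply ex_filterdiff_linear. exact is_linear_snd. Qed.

Lemma differentiableC_const c p : differentiableC (fun _ => c) p.
Proof. split; apply differentiable_const. Qed.

Lemma differentiableC_RtoC h p :
  differentiable h p -> differentiableC (fun q => RtoC (h q)) p.
Proof. intros H. split; [ exact H | exact (differentiable_const 0 p) ]. Qed.

Lemma differentiableC_expi k h p :
  differentiable h p -> differentiableC (fun q => expi (k * h q)) p.
Proof.
  intros H. split.
  - apply (differentiable_comp (fun x => cos (k * x)));
      [ auto_derive; trivial | exact H ].
  - apply (differentiable_comp (fun x => sin (k * x)));
      [ auto_derive; trivial | exact H ].
Qed.

Lemma differentiableC_mode N mu c u v r theta phi psi :
  ex_derive u r -> ex_derive v theta ->
  differentiableC (mode N mu c u v) (r, theta, phi, psi).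
Proof.
  intros Hu Hv.
  assert (H : differentiableC (fun q : point =>
    (expi (N * snd (fst q)) * (c * expi (mu * snd q) * u (fst (fst (fst q)))
      * v (snd (fst (fst q)))))%C) (r, theta, phi, psi)).
  { apply differentiableC_mult.
    - apply differentiableC_expi, differentiable_phi.
    - apply differentiableC_mult; [ apply differentiableC_mult;
        [ apply differentiableC_mult | ] | ].
      + apply differentiableC_const.
      + apply differentiableC_expi, differentiable_psi.
      + apply differentiableC_RtoC.
        apply (differentiable_comp u); [ exact Hu | apply differentiable_r ].
      + apply differentiableC_RtoC.
        apply (differentiable_comp v); [ exact Hv | apply differentiable_theta ]. }
  split; [ destruct H as [H _] | destruct H as [_ H] ]; revert H;
    apply ex_filterdiff_ext; intros [[[r' theta'] phi'] psi']; reflexivity.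
Qed.

Lemma differentiableC_pair h p :
  differentiableC h p ->
  ex_filterdiff (K := R_AbsRing) (U := point_space) (V := C_R_NormedModule)
    h (locally p).
Proof.
  intros [Hr Hi].
  apply (ex_filterdiff_ext (V := C_R_NormedModule) (fun q => (Re (h q), Im (h q)))).
  - intros q. now destruct (h q).
  - apply (ex_filterdiff_comp'_2 (W := C_R_NormedModule)
             (fun q => Re (h q)) (fun q => Im (h q)) (fun x y => (x, y) : C)); trivial.
    apply (ex_filterdiff_ext (U := prod_NormedModule _ R_NormedModule R_NormedModule)
             (V := C_R_NormedModule) (fun z => z)).
    + intros [x y]. reflexivity.
    + apply ex_filterdiff_linear. exact (is_linear_id (V := C_R_NormedModule)).
Qed.

(** * Harmonicity *)

Lemma Rpower_quarter x : 0 < x ->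
  Rpower x (1 / 4) ^ 2 = sqrt x /\ Rpower x (1 / 4) ^ 4 = x.
Proof.
  intros Hx.
  assert (H : Rpower x (1 / 4) ^ 2 = sqrt x).
  { rewrite <- Rpower_sqrt by exact Hx. simpl. rewrite Rmult_1_r, <- Rpower_plus.
    f_equal. field. }
  split; [ exact H | ].
  replace (Rpower x (1 / 4) ^ 4) with ((Rpower x (1 / 4) ^ 2) ^ 2) by ring.
  rewrite H. apply pow2_sqrt. lra.
Qed.

(** With the inner radius [r0] as parameter the constants of the metric are
    polynomials, so that no roots enter the radial identities. *)
Lemma EH_spinor_harmonic (d m n r0 : R) (C1 C2 C3 C4 : C) :
  2 < d -> 0 < r0 ->
  harmonic_spinor (- ((d - 2) / 2 * r0 ^ 2)) ((d - 1) * r0 ^ 4) r0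
    (EH_spinor d m n r0 C1 C2 C3 C4).
Proof.
  intros Hd Hr0 [[[r theta] phi] psi] [Hr Ht].
  set (A := - ((d - 2) / 2 * r0 ^ 2)). set (B := (d - 1) * r0 ^ 4).
  assert (Hx : 0 < r ^ 2 - r0 ^ 2) by nra.
  assert (Hy : 0 < r ^ 2 + (d - 1) * r0 ^ 2) by nra.
  assert (HW : 0 < EH_W A B r).
  { unfold A, B. rewrite EH_W_factor by lra.
    apply Rdiv_lt_0_compat; [ apply Rmult_lt_0_compat; assumption | apply pow_lt; lra ]. }
  pose (mu := fun j => match j with
    | 0%nat | 2%nat => d / 2 * (m + 1 / 2) | _ => d / 2 * (m - 1 / 2) end).
  pose (c := fun j => match j with
    | 0%nat => C1 | 1%nat => C2 | 2%nat => C3 | _ => C4 end).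
  pose (u := fun j => match j with
    | 0%nat => u1 d m r0 | 1%nat => u2 d m r0
    | 2%nat => u3 d m r0 | _ => u4 d m r0 end).
  pose (v := fun j => match j with
    | 0%nat | 2%nat => v1 d m n | _ => v2 d m n end).
  pose (a := fun j => match j with
    | 0%nat => u1_log_derivative d m r0 r
    | 1%nat => u1_log_derivative d (- m) r0 r
    | 2%nat => u3_log_derivative d m r0 r
    | _ => u3_log_derivative d (- m) r0 r end).
  pose (b := fun j => spin_sign j * (n + 1 / 2 - mu j * cos theta) / sin theta).
  assert (Hmode : forall j q, component_index j ->
    component (EH_spinor d m n r0 C1 C2 C3 C4 q) j
    = mode (n + 1 / 2) (mu j) (c j) (u j) (v j) q).
  { intros j [[[r' theta'] phi'] psi'] Hj. unfold component_index in Hj.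
    destruct j as [|[|[|[|j]]]]; try (exfalso; lia); reflexivity. }
  assert (Hu : forall j, component_index j -> is_log_derive (u j) r (a j)).
  { intros j Hj. unfold component_index in Hj.
    destruct j as [|[|[|[|j]]]]; try (exfalso; lia); unfold u, a.
    - apply is_log_derive_u1; assumption.
    - apply (is_log_derive_ext (u1 d (- m) r0)).
      + intros y. symmetry. apply u2_eq_u1.
      + apply is_log_derive_u1; assumption.
    - apply is_log_derive_u3; lra.
    - apply (is_log_derive_ext (u3 d (- m) r0)).
      + intros y. symmetry. apply u4_eq_u3.
      + apply is_log_derive_u3; lra. }
  assert (Hv : forall j, component_index j -> is_log_derive (v j) theta (b j)).
  { assert (H1 := is_log_derive_v1 d m n theta Ht).
    assert (H2 := is_log_derive_v1 d (- m) (- n - 1) theta Ht).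
    apply (is_log_derive_ext _ (v2 d m n)) in H2;
      [ | intros y; symmetry; apply v2_eq_v1 ].
    assert (Hs : 0 < sin theta) by (apply sin_gt_0; lra).
    intros j Hj. unfold component_index in Hj.
    destruct j as [|[|[|[|j]]]]; try (exfalso; lia); unfold v, b, mu, spin_sign.
    all: [> revert H1 | revert H2 | revert H1 | revert H2];
      unfold is_log_derive;
      match goal with |- is_derive _ _ (?e * _) -> is_derive _ _ (?e' * _) =>
      replace e' with e; [ trivial | field; lra ] end. }
  split.
  - intros j Hj. apply differentiableC_pair.
    destruct (differentiableC_mode (n + 1 / 2) (mu j) (c j) (u j) (v j)
                r theta phi psi) as [Hre Him].
    + eexists. apply Hu, Hj.
    + eexists. apply Hv, Hj.
    + split; [ revert Hre | revert Him ]; apply ex_filterdiff_ext; intros q;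
        rewrite <- Hmode by exact Hj; reflexivity.
  - assert (Hreg : EH_regular A B (r, theta, phi, psi)).
    { repeat split; [ lra | exact HW | apply sin_gt_0; lra ]. }
    apply (coeff_mat_ext_aux (RtoC 0) (RtoC 0)). intros i j Hi Hj.
    replace j with 0%nat by lia.
    unfold spinor_zero. rewrite coeff_mat_bij by lia.
    apply (EH_dirac_modes A B r theta phi psi _ (n + 1 / 2) mu c u v a b i); trivial.
    + intros k Hk. apply radial_equation_intro; [ lra | exact HW | ].
      unfold component_index in Hk.
      destruct k as [|[|[|[|k]]]]; try (exfalso; lia); unfold a, mu, A, B;
        first [ rewrite radial_identity_u1 by lra | rewrite radial_identity_u3 by lra ];
        cbn; field.
    + intros k Hk. unfold angular_equation, b. field.
      apply Rgt_not_eq, sin_gt_0; lra.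
Qed.

Theorem theorem4p1 (d : Z) (hd : (2 < d)%Z) (B : R) (hB : 0 < B)
    (m n : Z) (C1 C2 C3 C4 : C) :
  let A := - ((IZR d - 2) / 2 * sqrt (B / (IZR d - 1))) in
  let r0 := Rpower (B / (IZR d - 1)) (1 / 4) in
  harmonic_spinor A B r0
    (EH_spinor (IZR d) (IZR m) (IZR n) r0 C1 C2 C3 C4).
Proof.
  intros A r0.
  assert (Hd : 2 < IZR d) by (apply (IZR_lt 2), hd).
  assert (HB : 0 < B / (IZR d - 1)) by (apply Rdiv_lt_0_compat; lra).
  destruct (Rpower_quarter _ HB) as [H2 H4]. fold r0 in H2, H4.
  replace A with (- ((IZR d - 2) / 2 * r0 ^ 2)) by (unfold A; rewrite H2; reflexivity).
  replace B with ((IZR d - 1) * r0 ^ 4) by (rewrite H4; field; lra).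
  apply EH_spinor_harmonic; [ exact Hd | apply exp_pos ].
Qed.
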